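(* Let $0<\varepsilon\le 1/2$ and let $f:\{0,1\}^n\to\{0,1\}$ be accessed by queries. The algorithm Intersecting-Tester described below makes $n^{O(\sqrt{n\log(1/\varepsilon)})}/\varepsilon$ queries to $f$, and: (1) if $f$ is intersecting, it outputs ''intersecting'' with probability $1$; (2) if $\mathsf{dist}_{\mathsf{int}}(f)>\varepsilon$, it outputs ''$\varepsilon$-far from intersecting'' with probability at least $9/10$.
   Context: $|x|$ is the number of ones of $x\in\{0,1\}^n$; $\bar x$ is the bitwise complement; $y\le x$ is coordinatewise order. $f$ is intersecting if whenever $f(x)=f(y)=1$ there is $i$ with $x_i=y_i=1$; $\mathsf{dist}_{\mathsf{int}}(f)$ is the minimum over intersecting $g$ of $\Pr_{\mathbf x}[f(\mathbf x)\ne g(\mathbf x)]$, $\mathbf x$ uniform. Let $I:=[n/2-\sqrt{2n\ln(4/\varepsilon)},\,n/2+\sqrt{2n\ln(4/\varepsilon)}]$ and $\mathcal M=\{x:|x|\in I\}$. Intersecting-Tester: repeat $100/\varepsilon$ times: sample $\mathbf x$ uniformly from $\mathcal M$; let $\overline{\mathbf x}_\downarrow=\{y\le\overline{\mathbf x}: y\in\mathcal M\}$; query $f(\mathbf x)$ and $f(y)$ for every $y\in\overline{\mathbf x}_\downarrow$; if some $y\in\overline{\mathbf x}_\downarrow$ has $f(y)=f(\mathbf x)=1$, output ''$\varepsilon$-far from intersecting''. If no repetition does so, output ''intersecting''. *)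

(* Defs.v *)
From HB Require Import structures.
From mathcomp Require Export all_boot all_order all_algebra.
From mathcomp Require Export reals exp.

Set Implicit Arguments.
Unset Strict Implicit.
Unset Printing Implicit Defensive.
Import Order.TTheory GRing.Theory Num.Theory.

Local Open Scope ring_scope.

Notation cube n := {ffun 'I_n -> bool}.
Notation boolfun n := {ffun cube n -> bool}.

Section Cube.
Variable n : nat.
Implicit Types (x y : cube n) (f g : boolfun n).

Definition weight x : nat := #|[set i | x i]|.

Definition compl x : cube n := [ffun i => ~~ x i].

Definition cube_le y x : bool := [forall i, y i ==> x i].

(* The case x = y is included: an intersecting f vanishes at the all-zero
   point. *)
Definition intersecting f : bool :=
  [forall x, forall y, f x && f y ==> [exists i, x i && y i]].

Definition dist (R : realType) f g : R :=
  #|[set x | f x != g x]|%:R / #|{: cube n}|%:R.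

(* The default value 1 of the minimum plays no role: the constant function 0
   is intersecting, and every distance is at most 1. *)
Definition dist_int (R : realType) f : R :=
  \big[Num.min/1]_(g : boolfun n | intersecting g) dist R f g.

End Cube.

(* Randomized algorithms with query access to an unknown function on the cube,
   as decision trees whose nodes either query a point and branch on the answer,
   or draw a uniform point of a given set and branch on it. *)
Inductive query_alg (n : nat) (A : Type) : Type :=
| Return of A
| Query of cube n & (bool -> query_alg n A)
| Sample of {set cube n} & (cube n -> query_alg n A).

Arguments Return {n A}.
Arguments Query {n A}.
Arguments Sample {n A}.

Section Semantics.
Variables (n : nat) (f : boolfun n).

Fixpoint prob_output (R : realType) (A : eqType) (p : query_alg n A) (a : A)
    : R :=
  match p with
  | Return b => (b == a)%:R
  | Query x k => prob_output R (k (f x)) a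
  | Sample D k => (\sum_(x in D) prob_output R (k x) a) / #|D|%:R
  end.

(* Worst case over the random choices of the algorithm; repeated queries of
   the same point are counted each time. *)
Fixpoint num_queries (A : Type) (p : query_alg n A) : nat :=
  match p with
  | Return _ => 0%N
  | Query x k => (num_queries (k (f x))).+1
  | Sample D k => (\max_(x in D) num_queries (k x))%N
  end.

End Semantics.

(* Queries all the points of s in turn and passes the list of answers on. *)
Fixpoint query_all (n : nat) (A : Type) (s : seq (cube n))
    (k : seq bool -> query_alg n A) : query_alg n A :=
  if s is y :: s' then
    Query y (fun b => query_all s' (fun bs => k (b :: bs)))
  else k [::].

Inductive verdict := Intersecting | FarFromIntersecting.

Definition is_far (v : verdict) : bool :=
  if v is FarFromIntersecting then true else false.

Definition verdict_of_bool (b : bool) : verdict :=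
  if b then FarFromIntersecting else Intersecting.

Lemma is_farK : cancel is_far verdict_of_bool.
Proof. by case. Qed.

HB.instance Definition _ := Equality.copy verdict (can_type is_farK).

Section Tester.
Variables (R : realType) (n : nat) (eps : R).

Definition half_width : R := Num.sqrt (2 * n%:R * ln (4 / eps)).

Definition middle : {set cube n} :=
  [set x | n%:R / 2 - half_width <= (weight x)%:R <= n%:R / 2 + half_width].

Definition compl_down (x : cube n) : {set cube n} :=
  [set y in middle | cube_le y (compl x)].

Definition tester_round (next : query_alg n verdict) : query_alg n verdict :=
  Sample middle (fun x =>
    Query x (fun fx =>
      query_all (enum (compl_down x)) (fun fys =>
        if has (fun fy => fy && fx) fys then Return FarFromIntersecting
        else next))).

(* 100 / eps need not be an integer; it is rounded up. *)
Definition num_rounds : nat := `|Num.ceil (100 / eps)|%N.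

Definition intersecting_tester : query_alg n verdict :=
  iter num_rounds tester_round (Return Intersecting).

End Tester.

Arguments intersecting_tester {R} n eps.

(* Main.v *)
(* By a Chernoff bound at most an eps/2 fraction of the cube lies outside the
   middle layers.  Call a middle point x violating if f x = 1 and f y = 1 for
   some middle y disjoint from x.  Erasing f at the violating points and outside
   the middle layers makes it intersecting, so if f is eps-far, at least an
   eps/2 fraction of the points is violating; each round catches one of them
   with probability p >= eps/2, and 100/eps rounds all miss with probability at
   most 1 / (1 + 50).  A round makes few queries because y, lying in the middle
   layers and below the complement of x, differs from it in at most
   2 sqrt(2 n ln(4/eps)) coordinates. *)
Require Import Defs.
From mathcomp Require Import sequences ring lra.
Import Order.TTheory GRing.Theory Num.Theory.
Local Open Scope ring_scope.

Set Implicit Arguments.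
Unset Strict Implicit.

(** * Elementary inequalities and a count of small sets *)

Lemma expRD_expRN_le (R : realType) (t : R) :
  expR t + expR (- t) <= 2 * expR (2 * t ^+ 2).
Proof.
wlog t0 : t / 0 <= t.
  move=> W; have [/W//|/ltW] := leP 0 t.
  by rewrite -oppr_ge0 => /W; rewrite opprK addrC sqrrN.
(* Beyond 1/2, [t <= 2 * t ^+ 2] bounds each exponential separately. Below, [expR x <= (1 - x)^-1]
   bounds the sum by [2 / (1 - t ^+ 2)]. *)
have [t1|t1] := leP t (1 / 2); last first.
  have : expR t <= expR (2 * t ^+ 2) by rewrite ler_expR; nra.
  have : expR (- t) <= expR (2 * t ^+ 2) by rewrite ler_expR; nra.
  lra.
have inv_le (x : R) : x < 1 -> expR x <= (1 - x)^-1.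
  move=> x1; rewrite -[expR x]invrK lef_pV2 ?posrE ?invr_gt0 ?expR_gt0 ?subr_gt0 //.
  by rewrite -expRN expR_ge1Dx.
have h1 := inv_le t ltac:(lra); have h2 := inv_le (- t) ltac:(lra).
have h3 := expR_ge1Dx (2 * t ^+ 2).
have h4 : (1 - t)^-1 + (1 - - t)^-1 = 2 / (1 - t ^+ 2).
  by field; apply/and3P; split; apply: lt0r_neq0; nra.
have h5 : 2 / (1 - t ^+ 2) <= 2 * expR (2 * t ^+ 2).
  have t2 : t ^+ 2 <= 1 / 4 by nra.
  rewrite ler_pdivrMr; last by lra.
  have : (1 + 2 * t ^+ 2) * (1 - t ^+ 2) <= expR (2 * t ^+ 2) * (1 - t ^+ 2).
    by rewrite ler_wpM2r //; lra.
  nra.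
lra.
Qed.

(** Bounds the chance that [k] independent trials all miss by 1 / (1 + kp), with no exponentials. *)
Lemma compl_exprn_le (R : realFieldType) (p : R) (k : nat) :
  0 <= p <= 1 -> (1 - p) ^+ k * (1 + k%:R * p) <= 1.
Proof.
case/andP=> p0 p1; elim: k => [|k IHk]; first by rewrite expr0; lra.
rewrite exprSr -natr1.
have q0 : 0 <= (1 - p) ^+ k by rewrite exprn_ge0 // subr_ge0.
have k0 : 0 <= k%:R * p by rewrite mulr_ge0.
apply: le_trans IHk; rewrite -mulrA ler_wpM2l //; nra.
Qed.

(** A nonempty set of size at most d+1 is a point added to a set of size at most d; [None] adds
    nothing and covers the empty set. *)
Lemma card_small_sets (T : finType) (d : nat) :
  (#|[set A : {set T} | #|A| <= d]| <= #|T|.+1 ^ d)%N.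
Proof.
elim: d => [|d IHd].
  rewrite expn0 -(cards1 (set0 : {set T})) subset_leq_card //.
  by apply/subsetP => A; rewrite !inE leqn0 cards_eq0.
pose add (u : option T * {set T}) := if u.1 is Some i then i |: u.2 else u.2.
rewrite expnS; apply: leq_trans (leq_mul (leqnn _) IHd).
rewrite -card_option -cardsT -cardsX.
apply: leq_trans (leq_imset_card add _).
apply/subset_leq_card/subsetP => A; rewrite inE => leA.
have [->|[i iA]] := set_0Vmem A.
  by apply/imsetP; exists (None, set0); rewrite // !inE cards0.
apply/imsetP; exists (Some i, A :\ i); last by rewrite /add /= setD1K.
by rewrite !inE /= -ltnS; rewrite (cardsD1 i A) iA in leA.
Qed.

(** * Chernoff bound for the weight *)

Section Cube.
Variable n : nat.
Implicit Types (x y : cube n) (f g : boolfun n).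

Lemma weightE (R : realType) x : (weight x)%:R = \sum_i (x i)%:R :> R.
Proof.
rewrite /weight cardsE -sum1_card natr_sum big_mkcond /=.
by apply: eq_bigr => i _; rewrite -topredE /=; case: (x i).
Qed.

Lemma weight_le x : (weight x <= n)%N.
Proof. by rewrite -[X in (_ <= X)%N]card_ord max_card. Qed.

Lemma weight_compl x : (weight (compl x) + weight x = n)%N.
Proof.
rewrite -[RHS]card_ord -(cardsC [set i | x i]) addnC; congr (_ + #|pred_of_set _|)%N.
by apply/setP => i; rewrite !inE ffunE.
Qed.

(** Moment generating function: 2|x| - n is a sum of n signs, so the sum factors over
    coordinates. *)
Lemma sum_expR_weight (R : realType) (t : R) :
  \sum_(x : cube n) expR (t * (2 * (weight x)%:R - n%:R)) =
  (expR t + expR (- t)) ^+ n.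
Proof.
transitivity (\prod_(i < n) \sum_(b : bool) expR (t * (2 * b%:R - 1))).
  rewrite bigA_distr_bigA; apply: eq_bigr => x _.
  rewrite -expR_sum -mulr_sumr sumrB -mulr_sumr -weightE.
  by rewrite sumr_const card_ord.
rewrite prodr_const card_ord big_bool /=; congr ((expR _ + expR _) ^+ _); ring.
Qed.

Lemma card_cube (R : realType) : #|{: cube n}|%:R = 2 ^+ n :> R.
Proof. by rewrite card_ffun card_bool card_ord natrX. Qed.

Lemma weight_tail (R : realType) (t w : R) : 0 <= t ->
  #|[set x : cube n | w < 2 * (weight x)%:R - n%:R]|%:R * expR (t * w)
    <= 2 ^+ n * expR (2 * t ^+ 2 * n%:R) /\
  #|[set x : cube n | 2 * (weight x)%:R - n%:R < - w]|%:R * expR (t * w)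
    <= 2 ^+ n * expR (2 * t ^+ 2 * n%:R).
Proof.
move=> t0.
have mgf : (expR t + expR (- t)) ^+ n <= 2 ^+ n * expR (2 * t ^+ 2 * n%:R).
  rewrite expRM_natr -exprMn lerXn2r ?nnegrE ?expRD_expRN_le //.
    by rewrite addr_ge0 ?expR_ge0.
  by rewrite mulr_ge0 ?expR_ge0.
have markov s (A : {set cube n}) :
    (forall x, x \in A -> t * w <= s * (2 * (weight x)%:R - n%:R)) ->
    #|A|%:R * expR (t * w) <= (expR s + expR (- s)) ^+ n.
  move=> le_s; rewrite -sum_expR_weight mulr_natl -sumr_const.
  rewrite [leRHS](bigID (mem A)) /= -[leLHS]addr0 lerD //.
    by apply: ler_sum => x xA; rewrite ler_expR le_s.
  by apply: sumr_ge0 => x _; rewrite expR_ge0.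
split; apply: le_trans mgf.
  by apply: markov => x; rewrite inE => /ltW wx; rewrite ler_wpM2l.
(* The lower tail is the Markov bound with parameter [- t]. *)
have -> : expR t + expR (- t) = expR (- t) + expR (- - t).
  by rewrite opprK addrC.
apply: markov => x; rewrite inE => /ltW wx; nra.
Qed.

End Cube.

(** * Middle layers and violating points *)

Section Middle.
Variables (R : realType) (n : nat) (eps : R).
Implicit Types (x y : cube n) (f g : boolfun n).

Lemma ln4eps_ge0 (eps_gt0 : 0 < eps) (eps_le1 : eps <= 1) : 0 <= ln (4 / eps).
Proof. by rewrite ln_ge0 // ler_pdivlMr //; lra. Qed.

Lemma sqr_half_width (eps_gt0 : 0 < eps) (eps_le1 : eps <= 1) :
  half_width n eps ^+ 2 = 2 * n%:R * ln (4 / eps).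
Proof. by rewrite sqr_sqrtr // !mulr_ge0 ?ln4eps_ge0. Qed.

Lemma half_width_ge0 : 0 <= half_width n eps.
Proof. exact: sqrtr_ge0. Qed.

Lemma card_setC_middle (eps_gt0 : 0 < eps) (eps_le1 : eps <= 1) :
  #|~: middle n eps|%:R <= eps / 2 * 2 ^+ n.
Proof.
set w := half_width n eps; set L := ln (4 / eps).
case: (posnP n) => [n0|n_gt0].
  suff -> : ~: middle n eps = set0 by rewrite cards0 mulr_ge0 ?exprn_ge0 //; lra.
  apply/setP => x; rewrite !inE; apply/negbTE; rewrite negbK.
  have -> : weight x = 0%N by apply/eqP; rewrite -leqn0 -n0 weight_le.
  by rewrite -/w n0 mul0r sub0r add0r oppr_le0 half_width_ge0.
have w2 := sqr_half_width eps_gt0 eps_le1; rewrite -/w -/L in w2.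
have n0 : n%:R != 0 :> R by rewrite pnatr_eq0 -lt0n.
(* Optimal Chernoff parameter for the variance proxy of [expRD_expRN_le]. *)
pose t := w / (2 * n%:R).
have t0 : 0 <= t by rewrite divr_ge0 ?half_width_ge0 ?mulr_ge0.
have tw : t * (2 * w) = 2 * L.
  have -> : t * (2 * w) = w ^+ 2 / n%:R by rewrite /t; field.
  by rewrite w2; field.
have tt : 2 * t ^+ 2 * n%:R = L.
  have -> : 2 * t ^+ 2 * n%:R = w ^+ 2 / (2 * n%:R) by rewrite /t; field.
  by rewrite w2; field.
have [hi lo] := weight_tail n (2 * w) t0.
have expL : expR L = 4 / eps by rewrite lnK // posrE divr_gt0.
(* The exponents are 2L and L; cancelling one [expR L = 4 / eps] leaves an eps/4 share for each
   tail. *)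
have cut (a : R) : a * expR (t * (2 * w)) <= 2 ^+ n * expR (2 * t ^+ 2 * n%:R) ->
    a <= eps / 4 * 2 ^+ n.
  have L0 := expR_gt0 L.
  rewrite tw tt mulr_natl mulr2n expRD mulrA ler_pM2r // -ler_pdivlMr // expL.
  by rewrite invf_div mulrC.
have := lerD (cut _ hi) (cut _ lo).
have -> : eps / 4 * 2 ^+ n + eps / 4 * 2 ^+ n = eps / 2 * 2 ^+ n by field.
apply: le_trans; rewrite -natrD ler_nat.
apply: leq_trans (leq_card_setU _ _); apply/subset_leq_card/subsetP => x.
rewrite !inE negb_and -!ltNge => /orP[] h; apply/orP; [right|left];
  rewrite -/w in h; lra.
Qed.

Lemma middle_neq0 (eps_gt0 : 0 < eps) (eps_le1 : eps <= 1) : middle n eps != set0.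
Proof.
apply/eqP => M0; have := card_setC_middle eps_gt0 eps_le1.
rewrite M0 setC0 cardsT card_cube ler_pMl ?exprn_gt0 // => h; lra.
Qed.

Definition violating f : {set cube n} :=
  [set x in middle n eps | f x && [exists y in compl_down eps x, f y]].

(* Erasing f outside the middle layers and at the violating points leaves an
   intersecting function. *)
Lemma dist_int_le f :
  dist_int R f <= (#|violating f| + #|~: middle n eps|)%:R / 2 ^+ n.
Proof.
pose g : boolfun n :=
  [ffun x => [&& f x, x \in middle n eps & x \notin violating f]].
have int_g : intersecting g.
  apply/forallP => x; apply/forallP => y; apply/implyP.
  rewrite !ffunE => /andP[/and3P[fx xM xV] /and3P[fy yM _]].
  (* If [x] and [y] were disjoint, [y] would lie below [compl x] and make [x] violating. *)
  apply: contraNT xV; rewrite negb_exists => /forallP disj.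
  rewrite inE xM fx; apply/existsP; exists y; rewrite inE yM fy !andbT.
  apply/forallP => i; rewrite ffunE; apply/implyP => yi.
  by have := disj i; rewrite yi andbT.
apply: le_trans (bigmin_le_cond _ _ int_g) _.
rewrite /dist card_cube ler_wpM2r ?invr_ge0 ?exprn_ge0 // ler_nat.
apply: leq_trans (leq_card_setU _ _); apply/subset_leq_card/subsetP => x.
rewrite inE ffunE in_setU in_setC.
by case: (f x); case: (x \in middle _ _); case: (x \in violating f).
Qed.

Lemma violating_ge f (eps_gt0 : 0 < eps) (eps_le1 : eps <= 1) : eps < dist_int R f ->
  eps / 2 <= #|violating f|%:R / #|middle n eps|%:R.
Proof.
move=> far; have N0 : 0 < 2 ^+ n :> R by rewrite exprn_gt0.
have M0 : (0 < #|middle n eps|)%N by rewrite card_gt0 middle_neq0.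
have MN : #|middle n eps|%:R <= 2 ^+ n :> R by rewrite -card_cube ler_nat max_card.
have := lt_le_trans far (dist_int_le f); have := card_setC_middle eps_gt0 eps_le1.
rewrite ltr_pdivlMr // natrD ler_pdivlMr ?ltr0n //.
move=> h1 h2; apply: le_trans (ler_wpM2l _ MN) _; lra.
Qed.

Lemma violating_intersecting f : intersecting f -> violating f = set0.
Proof.
move/forallP => int_f; apply/setP => x; rewrite !inE; apply/negP.
case/and3P=> _ fx /existsP[y /andP[]]; rewrite inE => /andP[_ /forallP yx] fy.
move/forallP/(_ y): (int_f x); rewrite fx fy /= => /existsP[i /andP[xi yi]].
by have := yx i; rewrite yi ffunE xi.
Qed.

End Middle.

(** * Output probabilities and query count *)

Section Run.
Variables (R : realType) (n : nat) (f : boolfun n).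

Lemma prob_output_query_all (A : eqType) s (k : seq bool -> query_alg n A) a :
  prob_output f R (query_all s k) a = prob_output f R (k (map f s)) a.
Proof. by elim: s k => //= y s IHs k; rewrite IHs. Qed.

Lemma num_queries_query_all (A : Type) s (k : seq bool -> query_alg n A) :
  num_queries f (query_all s k) = (size s + num_queries f (k (map f s)))%N.
Proof. by elim: s k => //= y s IHs k; rewrite IHs. Qed.

Variable eps : R.

Lemma has_violating x : x \in middle n eps ->
  has (fun fy => fy && f x) (map f (enum (compl_down eps x))) =
  (x \in violating eps f).
Proof.
move=> xM; rewrite inE xM /= has_map.
apply/hasP/andP => [[y] | [fx /existsP[y /andP[yx fy]]]].
  by rewrite mem_enum => yx /andP[fy fx]; split=> //; apply/existsP; exists y; rewrite yx.
by exists y; rewrite ?mem_enum //= fy fx.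
Qed.

Lemma prob_round next v :
  prob_output f R (tester_round eps next) v =
  (#|violating eps f|%:R * (FarFromIntersecting == v)%:R
   + (#|middle n eps|%:R - #|violating eps f|%:R) * prob_output f R next v)
  / #|middle n eps|%:R.
Proof.
have sVM : violating eps f \subset middle n eps.
  by apply/subsetP => x; rewrite inE => /andP[].
rewrite /=; congr (_ / _).
rewrite (eq_bigr (fun x => if x \in violating eps f
    then (FarFromIntersecting == v)%:R else prob_output f R next v)); last first.
  by move=> x xM; rewrite prob_output_query_all has_violating //; case: ifP.
rewrite (big_setID (violating eps f)) /= (setIidPr sVM); congr (_ + _).
  by rewrite (eq_bigr _ (fun x xV => ifT _ _ xV)) sumr_const mulr_natl.
rewrite -natrB ?subset_leq_card // -cardsDS // mulr_natl -sumr_const.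
by apply: eq_bigr => x; rewrite inE => /andP[/negbTE->].
Qed.

(** Each round independently stops with probability p, the share of violating points. Sampling from
    an empty set would give every verdict probability 0. *)
Lemma prob_rounds k : middle n eps != set0 ->
  prob_output f R (iter k (tester_round eps) (Return Intersecting)) Intersecting
    = (1 - #|violating eps f|%:R / #|middle n eps|%:R) ^+ k /\
  prob_output f R (iter k (tester_round eps) (Return Intersecting))
      FarFromIntersecting
    = 1 - (1 - #|violating eps f|%:R / #|middle n eps|%:R) ^+ k.
Proof.
move=> M0; have {M0} : #|middle n eps|%:R != 0 :> R by rewrite pnatr_eq0 cards_eq0.
move=> M0; elim: k => [|k [IH1 IH2]]; first by rewrite /= !expr0 subrr.
rewrite iterS !prob_round IH1 IH2 exprS.
by split=> /=; field.
Qed.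

(** The successor on [B] counts the query at the sampled point itself. *)
Lemma num_queries_rounds k B :
  (forall x, x \in middle n eps -> #|compl_down eps x| <= B)%N ->
  (num_queries f (iter k (tester_round eps) (Return Intersecting)) <= k * B.+1)%N.
Proof.
move=> leB; elim: k => //= k IHk; apply/bigmax_leqP => x xM.
rewrite num_queries_query_all -cardE mulSn addSn ltnS leq_add ?leB //.
by case: ifP.
Qed.

End Run.

(** * Size of the down-sets *)

Section CardComplDown.
Variables (R : realType) (n : nat) (eps : R).

(* A point y of the down-set is the complement of x minus a set of size
   (n - |x|) - |y|, at most twice the half-width. *)
Lemma card_compl_down (x : cube n) (d : nat) :
  2 * half_width n eps < d.+1%:R -> x \in middle n eps ->
  (#|compl_down eps x| <= n.+1 ^ d)%N.
Proof.
move=> wd; rewrite inE => /andP[x1 x2].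
pose D (y : cube n) := [set i | compl x i] :\: [set i | y i].
have inj_D : {in compl_down eps x &, injective D}.
  move=> y z; rewrite !inE => /andP[_ /forallP yx] /andP[_ /forallP zx] eqD.
  apply/ffunP => i; move/setP/(_ i): eqD; rewrite !inE.
  by move: (yx i) (zx i); case: (y i); case: (z i); case: (compl x i).
rewrite -(card_in_imset inj_D).
have := card_small_sets 'I_n d; rewrite card_ord; apply: leq_trans.
apply/subset_leq_card/subsetP => _ /imsetP[y + ->].
rewrite !inE => /andP[/andP[y1 y2] /forallP yx].
have sub : [set i | y i] \subset [set i | compl x i].
  by apply/subsetP => i; rewrite !inE; apply/implyP.
rewrite cardsDS // -/(weight y) -/(weight (compl x)) -ltnS -(ltr_nat R).
apply: le_lt_trans wd; rewrite natrB ?subset_leq_card //.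
have : (weight (compl x))%:R + (weight x)%:R = n%:R :> R by rewrite -natrD weight_compl.
lra.
Qed.

End CardComplDown.

(* The constant C of the O(.) is absolute: it precedes n, eps and f.  The query
   bound is asymptotic in n and is stated for n >= 2, since n `^ a <= 1 for
   n <= 1 while the tester runs at least 100 / eps rounds. *)
Theorem theorem5p13 (R : realType) :
  exists C : R, 0 < C /\
    forall (n : nat) (eps : R) (f : {ffun {ffun 'I_n -> bool} -> bool}),
      0 < eps -> eps <= 1 / 2 ->
      [/\ (2 <= n)%N ->
            (num_queries f (intersecting_tester n eps))%:R
              <= n%:R `^ (C * Num.sqrt (n%:R * ln (1 / eps))) / eps,
          intersecting f ->
            prob_output f R (intersecting_tester n eps) Intersecting = 1
        & eps < dist_int R f ->
            9 / 10 <= prob_output f R (intersecting_tester n eps)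
                                      FarFromIntersecting].
Proof.
(* The exponent of n is at most 7 + (2d + 1), with d <= 5S and 1 <= S, hence at most 18S. *)
exists 18; split=> // n eps f eps0 eps_half.
have eps1 : eps <= 1 by lra.
have inv_eps : 2 <= 1 / eps by rewrite ler_pdivlMr //; lra.
have [pI pF] := prob_rounds f (num_rounds eps) (middle_neq0 n eps0 eps1).
have N0 : 0 < 100 / eps by rewrite divr_gt0.
have roundsE : (num_rounds eps)%:R = (Num.ceil (100 / eps))%:~R :> R.
  by rewrite /num_rounds natr_absz ger0_norm // ltW // ceil_gt0.
have /andP[rounds_lt rounds_ge] := ceil_itv (100 / eps).
rewrite intrD -roundsE in rounds_lt; rewrite -roundsE in rounds_ge.
split.
- move=> n2.
  have n1 : 1 <= n%:R :> R by rewrite ler1n ltnW.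
  set S := Num.sqrt _.
  pose l := ln (1 / eps).
  have ln2 : 1 / 2 <= ln 2 :> R.
    rewrite -[leLHS]expRK ler_ln ?posrE ?expR_gt0 //.
    have := expR_ge1Dx (- (1 / 2) : R); have := expRxMexpNx_1 (1 / 2 : R).
    have := expR_gt0 (1 / 2 : R); nra.
  have l1 : ln 2 <= l by rewrite ler_ln ?posrE ?divr_gt0.
  have l0 : 0 <= l by lra.
  have S2 : S ^+ 2 = n%:R * l by rewrite sqr_sqrtr // mulr_ge0.
  have S0 : 0 <= S by exact: sqrtr_ge0.
  have S1 : 1 <= S.
    rewrite -(ler_pXn2r (n := 2)) ?nnegrE // expr1n S2.
    have n2R : 2 <= n%:R :> R by rewrite (ler_nat R 2).
    nra.
  (* As [ln 2 <= l], ln(4/eps) = 2 ln 2 + l <= 3l, so the squared half-width is at most 6 S^2. *)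
  have wS : half_width n eps <= 5 / 2 * S.
    have w2 := sqr_half_width n eps0 eps1.
    have lnE : ln (4 / eps) = ln 2 *+ 2 + l.
      by rewrite -lnXn // -lnM ?posrE ?exprn_gt0 ?divr_gt0 // mulrA mulr1 -natrX.
    rewrite -(ler_pXn2r (n := 2)) ?nnegrE ?half_width_ge0 ?mulr_ge0 ?invr_ge0 //.
    rewrite w2 exprMn S2 lnE.
    have : n%:R * ln 2 <= n%:R * l by rewrite ler_wpM2l.
    have : 0 <= n%:R * l by rewrite -S2 exprn_ge0.
    lra.
  pose d := Num.truncn (2 * half_width n eps).
  have w0 : 0 <= 2 * half_width n eps by rewrite mulr_ge0 ?half_width_ge0.
  have /andP[d1 d2] : d%:R <= 2 * half_width n eps < d.+1%:R := truncn_itv w0.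
  have leB := num_queries_rounds f (num_rounds eps) (fun x => card_compl_down d2).
  rewrite -(ler_nat R) in leB; apply: le_trans leB _.
  (* For n >= 2, n + 1 <= n^2, and one more factor n absorbs the added 1. *)
  have B_le : ((n.+1 ^ d).+1 <= n ^ (2 * d).+1)%N.
    have nd : (n.+1 ^ d <= n ^ (2 * d))%N.
      rewrite expnM; case: d {d1 d2} => // k; rewrite leq_exp2r // -mulnn.
      by apply: leq_trans (leq_mul n2 (leqnn n)); rewrite mul2n -addnn -addn1 leq_add2l ltnW.
    rewrite expnS; apply: leq_trans (leq_mul n2 (leqnn _)).
    rewrite mul2n -addnn -addn1 leq_add // expn_gt0 ltnW //.
  (* Rounding up costs at most 1 <= 1/eps, and 101 <= 2^7 <= n^7. *)
  have R_le : (num_rounds eps)%:R <= n%:R ^+ 7 / eps.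
    have : 101 / eps <= n%:R ^+ 7 / eps.
      rewrite ler_pM2r ?invr_gt0 // -natrX ler_nat.
      by apply: (@leq_trans (2 ^ 7)); rewrite ?leq_exp2r.
    apply: le_trans; lra.
  rewrite natrM.
  apply: le_trans (ler_pM _ _ R_le (_ : _ <= (n ^ (2 * d).+1)%:R)) _ => //.
    by rewrite ler_nat.
  rewrite mulrAC ler_pM2r ?invr_gt0 // natrX -exprD -powR_mulrn //.
  rewrite ler_powR // natrD -[(2 * d).+1%:R]natr1 natrM.
  lra.
- move=> int_f; rewrite pI (violating_intersecting eps int_f) cards0 mul0r.
  by rewrite subr0 expr1n.
- move=> far; rewrite pF.
  have b := violating_ge eps0 eps1 far.
  move: b; set p := _ / _ => b.
  have p1 : p <= 1.
    rewrite ler_pdivrMr ?mul1r ?ler_nat ?subset_leq_card //.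
      by apply/subsetP => x; rewrite inE => /andP[].
    by rewrite ltr0n card_gt0 middle_neq0.
  (* At least 100/eps rounds, each succeeding with probability at least eps/2. *)
  have Np : 50 <= (num_rounds eps)%:R * p.
    have -> : 50 = 100 / eps * (eps / 2) by field; rewrite lt0r_neq0.
    by apply: ler_pM => //; lra.
  have p0 : 0 <= p <= 1 by lra.
  have := compl_exprn_le (num_rounds eps) p0.
  have : 0 <= (1 - p) ^+ num_rounds eps by rewrite exprn_ge0 //; lra.
  move: (_ ^+ _) => q; nra.
Qed.
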